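(* Let $T>0$ and $\alpha\in[0,1)$. For each $t\in(0,T]$, the truncated stochastic convolution satisfies, for $N\ge2$, $$\mathbb E\left\|P_NZ^{(\alpha)}(t)\right\|_{\mathcal H^1}^2\asymp\begin{cases}\ln(N),&\text{if }\alpha=0,\\ N^{2\alpha},&\text{if }\alpha\in(0,1),\end{cases}$$ where $\asymp$ means that the left-hand side is bounded from below and from above by the right-hand side up to two positive constants independent of $N$ (which may depend on $t$).
   Context: $\mathbb T^2=[0,L]^2$ is the two-dimensional torus of side length $L>0$. For $k=(k_1,k_2)\in\mathbb Z^2$, $e_k(x)=\omega_{k_1}(x_1)\omega_{k_2}(x_2)$, where $\omega_j(z)=\sqrt{2/L}\,\sin(2\pi jz/L)$ for $j>0$, $\omega_0(z)=1/\sqrt L$, $\omega_j(z)=\sqrt{2/L}\,\cos(2\pi jz/L)$ for $j<0$; these form an orthonormal basis of $L^2(\mathbb T^2)$ with $-\Delta e_k=\mu_ke_k$, $\mu_k=(2\pi|k|/L)^2$, $|k|$ the Euclidean norm. For mean-zero $u=\sum_{k\in\mathbb Z^2\setminus\{0\}}u_ke_k$, $\|u\|_{\mathcal H^1}^2=\sum_{k\ne0}\mu_k|u_k|^2$. $(\beta_k)_{k\in\mathbb Z^2\setminus\{0\}}$ are i.i.d. standard real Brownian motions, $Z_k(t)=\int_0^te^{-(t-s)\mu_k^2}\,d\beta_k(s)$, $Z^{(\alpha)}(t)=\sum_{k\ne0}\mu_k^{\alpha/2}Z_k(t)e_k$, and $P_NZ^{(\alpha)}(t)=\sum_{0<|k|\le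 N}\mu_k^{\alpha/2}Z_k(t)e_k$ for $N\in\mathbb N$. *)

(* Defs.v *)
From HB Require Import structures.
From mathcomp Require Import all_boot all_order all_algebra.
From mathcomp Require Import finmap.
From mathcomp Require Import all_classical all_reals all_analysis.

Set Implicit Arguments.
Unset Strict Implicit.
Unset Printing Implicit Defensive.

Import Order.TTheory GRing.Theory Num.Theory.
Import numFieldNormedType.Exports.

Local Open Scope classical_set_scope.
Local Open Scope ring_scope.

Section Independence.
Context {d : measure_display} {T : measurableType d} {R : realType}.
Variable P : probability T R.

Definition mutually_independent (I : choiceType) (D : set I)
    (G : I -> set_system T) : Prop :=
  forall (J : {fset I}) (A : I -> set T),
    [set` J] `<=` D ->
    (forall i, i \in J -> G i (A i)) ->
    P (\bigcap_(i in [set` J]) A i) = (\prod_(i <- J) P (A i))%E.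

Definition sigma_rv (X : T -> R) : set_system T :=
  preimage_set_system setT X measurable.

Definition sigma_process (X : R -> T -> R) : set_system T :=
  <<s \bigcup_(t in [set t : R | 0 <= t]) sigma_rv (X t) >>.

End Independence.

Section BrownianMotion.
Context {d : measure_display} {T : measurableType d} {R : realType}.
Variable P : probability T R.

Definition increment (B : R -> {RV P >-> R}) (s t : R) (w : T) : R :=
  B t w - B s w.

(* A Brownian motion is indexed by all of R for convenience; nothing is assumed
   about it at negative times. The second argument of normal_prob is the
   standard deviation. *)
Definition brownian_motion (B : R -> {RV P >-> R}) : Prop :=
  [/\ {ae P, forall w, B 0 w = 0},
      (forall t : nat -> R, 0 <= t 0%N -> {homo t : m n / (m <= n)%N >-> m <= n} ->
         mutually_independent P setT
           (fun i : nat => sigma_rv (increment B (t i) (t i.+1)))),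
      (forall s t : R, 0 <= s -> s < t ->
         forall A : set R, measurable A ->
           pushforward P (increment B s t) A =
           normal_prob 0 (Num.sqrt (t - s)) A) &
      {ae P, forall w, {within `[0, +oo[, continuous (fun t => B t w)}}].

(* The step function \sum_(i < n) a_i 1_(s_i, s_i+1] on [0, t]. *)
Record step_function (t : R) := StepFunction {
  step_size : nat;
  step_node : nat -> R;
  step_value : nat -> R;
  step_node_ge0 : 0 <= step_node 0%N;
  step_node_homo : {homo step_node : m n / (m <= n)%N >-> m <= n};
  step_node_le : step_node step_size <= t }.

Definition step_eval (t : R) (h : step_function t) (s : R) : R :=
  \sum_(i < step_size h)
    step_value h i * \1_`](step_node h i), (step_node h i.+1)] s.

Definition step_integral (B : R -> {RV P >-> R}) (t : R) (h : step_function t)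
    (w : T) : R :=
  \sum_(i < step_size h)
    step_value h i * increment B (step_node h i) (step_node h i.+1) w.

(* Y is (a version of) the Wiener integral \int_0^t f(s) dB(s): the limit in
   L^2(P) of the integrals of step functions converging to f in L^2([0, t]).
   By the Ito isometry the limit does not depend, up to a P-null set, on the
   approximating sequence. *)
Definition wiener_integral (B : R -> {RV P >-> R}) (t : R) (f : R -> R)
    (Y : {RV P >-> R}) : Prop :=
  exists h : nat -> step_function t,
    (fun n => \int[lebesgue_measure]_(s in `[0%R, t])
                ((f s - step_eval (h n) s) ^+ 2)%R%:E)%E @ \oo --> 0%E /\
    (fun n => \int[P]_w ((Y w - step_integral B (h n) w) ^+ 2)%R%:E)%E
      @ \oo --> 0%E.

End BrownianMotion.

Section Torus.
Context {R : realType}.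
Variable L : R.

Definition mode_norm (k : int * int) : R :=
  Num.sqrt (k.1%:~R ^+ 2 + k.2%:~R ^+ 2).

Definition laplace_eigenvalue (k : int * int) : R := (2 * pi * mode_norm k / L) ^+ 2.

Definition omega (j : int) (z : R) : R :=
  if 0 < j then Num.sqrt (2 / L) * sin (2 * pi * j%:~R * z / L)
  else if j == 0 then 1 / Num.sqrt L
  else Num.sqrt (2 / L) * cos (2 * pi * j%:~R * z / L).

Definition torus_basis (k : int * int) (x : R * R) : R :=
  omega k.1 x.1 * omega k.2 x.2.

Definition torus : set (R * R) := `[0, L] `*` `[0, L].

(* The L^2 inner product with the orthonormal basis function e_k. *)
Definition fourier_coef (u : R * R -> R) (k : int * int) : R :=
  \int[(@lebesgue_measure R \x @lebesgue_measure R)%E]_(x in torus)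
    (u x * torus_basis k x).

Definition H1_norm_sq (u : R * R -> R) : \bar R :=
  \esum_(k in [set k : int * int | k != 0])
    (laplace_eigenvalue k * `|fourier_coef u k| ^+ 2)%:E.

End Torus.

Section StochasticConvolution.
Context {d : measure_display} {T : measurableType d} {R : realType}.
Variable P : probability T R.
Variable L : R.

Definition iid_brownian_motions
    (beta : int * int -> R -> {RV P >-> R}) : Prop :=
  (forall k, k != 0 -> brownian_motion (beta k)) /\
  mutually_independent P [set k | k != 0]
    (fun k => sigma_process (fun t => beta k t : T -> R)).

Definition mode_convolution (beta Z : int * int -> R -> {RV P >-> R}) : Prop :=
  forall k t, k != 0 -> 0 <= t ->
    wiener_integral (beta k) t
      (fun s => expR (- (t - s) * laplace_eigenvalue L k ^+ 2)) (Z k t).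

(* The index set of the sum is finite, so that the finitely supported big
   operator is the actual sum. *)
Definition truncated_convolution (Z : int * int -> R -> {RV P >-> R})
    (alpha : R) (N : nat) (t : R) (w : T) (x : R * R) : R :=
  \sum_(k \in [set k : int * int | 0 < @mode_norm R k <= N%:R])
    (laplace_eigenvalue L k `^ (alpha / 2) *
     Z k t w * torus_basis L k x).

End StochasticConvolution.

(* Main.v *)
Require Import Defs.
From HB Require Import structures.
From mathcomp Require Import all_boot all_order all_algebra.
From mathcomp Require Import all_classical all_reals all_analysis.
From mathcomp Require Import measurable_realfun.
From mathcomp Require Import ring lra zify.

Set Implicit Arguments.
Unset Strict Implicit.
Unset Printing Implicit Defensive.

Import Order.TTheory GRing.Theory Num.Theory.
Import numFieldNormedType.Exports.

Local Open Scope classical_set_scope.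
Local Open Scope ring_scope.

(** By orthonormality of the basis (e_k), the squared H^1 norm of the truncated
    convolution is the finite sum of mu_k^(1 + alpha) Z_k(t)^2 over
    0 < |k| <= N.  Its expectation is a weighted sum of second moments, and the Ito
    isometry gives E Z_k(t)^2 = (1 - exp (- 2 t mu_k^2)) / (2 mu_k^2).  The
    numerator lies between a positive constant (its value at the smallest
    nonzero eigenvalue) and 1, so that the energy is comparable to the sum of
    mu_k^(alpha - 1), that is, to the lattice sum of |k|^(2 alpha - 2) over
    0 < |k| <= N ([energyE], [energy_bounds]).

    The lattice sum is compared with a one-dimensional one through
    a = max (|k_1|, |k_2|): it satisfies a <= |k| <= sqrt 2 a, and there are of the
    order of a lattice points for each value of a.  Hence the lattice sum is
    comparable to the sum of a^(2 alpha - 1) for a up to N from above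
    ([low_mode_sum_le]) and up to N / 2 from below ([low_mode_sum_ge]).  That
    sum is a discrete integral: its terms are comparable to the increments of
    a^(2 alpha) if alpha > 0, and of ln a if alpha = 0.

    The Ito isometry is built from the law of the increments.  A Gaussian of
    standard deviation s has second moment s^2, by integration by parts.  Thus
    E (B_t - B_s)^2 = t - s for all s <= t, and by polarization this
    makes the increments over non-overlapping intervals orthogonal in L^2
    ([increments_orthogonal]).  The isometry for step functions follows by
    expanding the square, and it passes to L^2 limits ([ito_isometry]). *)

(** * Power sums *)

Section PowerSums.
Context {R : realType}.
Implicit Types (a p x : R).

(** Bernoulli-type bound valid for every p > 0: the chain is
    (1 - x)^p <= exp (- p x) <= 1 / (1 + p x) <= 1 - p x / (1 + p). *)
Lemma powR_onem_le p x : 0 < p -> 0 <= x < 1 ->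
  (1 - x) `^ p <= 1 - p / (1 + p) * x.
Proof.
move=> p0 /andP[x0 x1].
have y0 : 0 < 1 - x by lra.
have ln_le : ln (1 - x) <= - x by apply: le_ln1Dx; lra.
have px0 : 0 <= p * x by rewrite mulr_ge0// ltW.
have pxp : p * x <= p by rewrite -[leRHS]mulr1 ler_wpM2l; lra.
have -> : (1 - x) `^ p = expR (p * ln (1 - x)).
  by rewrite /powR gt_eqF.
apply: (@le_trans _ _ (expR (- (p * x)))).
  by rewrite ler_expR -mulrN ler_wpM2l// ltW.
rewrite expRN; apply: (@le_trans _ _ (1 + p * x)^-1).
  by rewrite lef_pV2 ?expR_ge1Dx// posrE ?expR_gt0//; lra.
rewrite -subr_ge0.
have -> : 1 - p / (1 + p) * x - (1 + p * x)^-1 =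
   p * x * (p - p * x) / ((1 + p) * (1 + p * x)).
  by field; apply/andP; split; apply/eqP; lra.
apply: divr_ge0; apply: mulr_ge0; lra.
Qed.

(** Since 1 - x lies in (0, 1], the power p <= 2 is at least the square, which
    is at least 1 - 2 x. *)
Lemma powR_onem_ge p x : 0 < p <= 2 -> 0 <= x < 1 ->
  1 - 2 * x <= (1 - x) `^ p.
Proof.
move=> /andP[p0 p2] /andP[x0 x1].
apply: (@le_trans _ _ ((1 - x) `^ 2)).
  rewrite (powR_mulrn 2%N); last lra.
  by have := sqr_ge0 x; lra.
by apply: ger_powR => //; lra.
Qed.

(** Factoring out a^(p - 1) reduces the increments of a^p to the two bounds
    above at x = 1 / a. *)
Lemma powR_subr1 p a : 0 < p -> 1 <= a ->
  a `^ p - (a - 1) `^ p = a `^ (p - 1) * (a * (1 - (1 - a^-1) `^ p)).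
Proof.
move=> p0 a1; have a0 : 0 < a by lra.
rewrite mulrA [_ * a]mulrC mulr_powRB1//; last lra.
rewrite mulrBr mulr1 -powRM; [|lra|by rewrite subr_ge0 invf_le1].
by rewrite mulrBr mulr1 divff// gt_eqF.
Qed.

Lemma powR_diff_ge p a : 0 < p -> 1 <= a ->
  p / (1 + p) * a `^ (p - 1) <= a `^ p - (a - 1) `^ p.
Proof.
move=> p0 a1; have a0 : 0 < a by lra.
have [->|ne1] := eqVneq a 1.
  rewrite subrr !powR1 powR0 ?gt_eqF// subr0 mulr1.
  rewrite ler_pdivrMr; lra.
have agt1 : 1 < a by rewrite lt_def ne1.
rewrite powR_subr1// [leLHS]mulrC ler_wpM2l ?powR_ge0//.
have -> : p / (1 + p) = a * (p / (1 + p) * a^-1).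
  by rewrite mulrCA divff ?mulr1// gt_eqF.
have := @powR_onem_le p a^-1 p0; rewrite invr_ge0 invf_lt1// agt1 ltW//.
by rewrite ler_pM2l// => /(_ isT); lra.
Qed.

Lemma powR_diff_le p a : 0 < p <= 2 -> 1 <= a ->
  a `^ p - (a - 1) `^ p <= 2 * a `^ (p - 1).
Proof.
move=> /andP[p0 p2] a1; have a0 : 0 < a by lra.
have [->|ne1] := eqVneq a 1.
  by rewrite subrr !powR1 powR0 ?gt_eqF// subr0; lra.
have agt1 : 1 < a by rewrite lt_def ne1.
rewrite powR_subr1// [leRHS]mulrC ler_wpM2l ?powR_ge0//.
have -> : 2 = a * (2 * a^-1) by rewrite mulrCA divff ?mulr1// gt_eqF.
have := @powR_onem_ge p a^-1; rewrite p0 p2 invr_ge0 invf_lt1// agt1 ltW//.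
by rewrite ler_pM2l// => /(_ isT isT); lra.
Qed.

(** The shift of the exponent makes this the discrete analogue of n^p / p for
    p > 0, and the harmonic sum for p = 0. *)
Definition power_sum (p : R) (n : nat) : R :=
  \sum_(1 <= a < n.+1) a%:R `^ (p - 1).

Lemma power_sumS p n : power_sum p n.+1 = power_sum p n + n.+1%:R `^ (p - 1).
Proof. by rewrite /power_sum big_nat_recr. Qed.

(** Telescoping of [powR_diff_ge]. *)
Lemma power_sum_le p n : 0 < p -> p / (1 + p) * power_sum p n <= n%:R `^ p.
Proof.
move=> p0; elim: n => [|n IH]; first by rewrite /power_sum big_geq// mulr0 powR_ge0.
have := @powR_diff_ge p n.+1%:R p0; rewrite ler1n => /(_ isT).
have -> : n.+1%:R - 1 = n%:R :> R by rewrite -natr1 addrK.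
rewrite power_sumS mulrDr; lra.
Qed.

(** Telescoping of [powR_diff_le]. *)
Lemma power_sum_ge p n : 0 < p <= 2 -> n%:R `^ p <= 2 * power_sum p n.
Proof.
move=> /andP[p0 p2]; elim: n => [|n IH].
  by rewrite /power_sum big_geq// mulr0 powR0// gt_eqF.
have := @powR_diff_le p n.+1%:R; rewrite p0 p2 ler1n => /(_ isT isT).
have -> : n.+1%:R - 1 = n%:R :> R by rewrite -natr1 addrK.
rewrite power_sumS mulrDr; lra.
Qed.

(** Telescoping of 1 / (n + 1) <= ln (n + 1) - ln n, an instance of
    ln (1 + x) <= x at x = - 1 / (n + 1). *)
Lemma power_sum0_le n : (0 < n)%N -> power_sum 0 n <= 1 + ln n%:R.
Proof.
case: n => // n _; elim: n => [|n IH].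
  by rewrite power_sumS {1}/power_sum big_geq// powR1 ln1 add0r addr0.
rewrite power_sumS sub0r powR_inv1//.
have := @le_ln1Dx R (- (n.+2%:R)^-1).
have -> : 1 + - (n.+2%:R)^-1 = n.+1%:R / n.+2%:R :> R.
  by rewrite -(natr1 n.+1); field; rewrite gt_eqF//; have := ler0n R n; lra.
rewrite ln_div ?posrE ?ltr0n// ltrN2 invf_lt1 ?ltr0n// ltr1n => /(_ isT).
move: IH; move: (ln _) (ln _) (_^-1) (power_sum _ _) => a b c e; lra.
Qed.

(** Telescoping of ln (n + 1) - ln n <= 1 / n, an instance of
    ln (1 + x) <= x at x = 1 / n. *)
Lemma power_sum0_ge n : ln n.+1%:R <= power_sum 0 n.
Proof.
elim: n => [|n IH]; first by rewrite ln1 /power_sum big_geq.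
rewrite power_sumS sub0r powR_inv1//.
have := @le_ln1Dx R ((n.+1%:R)^-1).
have -> : 1 + (n.+1%:R)^-1 = n.+2%:R / n.+1%:R :> R.
  by rewrite -(natr1 n.+1); field; rewrite gt_eqF//; have := ler0n R n; lra.
rewrite ln_div ?posrE ?ltr0n// => /(_ _) H.
have {H} : ln n.+2%:R - ln n.+1%:R <= (n.+1%:R)^-1 :> R.
  by apply: H; apply: lt_trans (ltrN10 _) _; rewrite invr_gt0 ltr0n.
move: IH; move: (ln _) (ln _) (_^-1) (power_sum _ _) => a b c e; lra.
Qed.

Definition growth_rate (alpha : R) (N : nat) : R :=
  if alpha == 0 then ln N%:R else N%:R `^ (2 * alpha).

Lemma power_sum_growth_le (alpha : R) : 0 <= alpha < 1 ->
  exists2 C : R, 0 < C &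
    forall N : nat, (2 <= N)%N ->
      power_sum (2 * alpha) N <= C * growth_rate alpha N.
Proof.
move=> /andP[a0 a1]; rewrite /growth_rate; have [->|ane0] := eqVneq alpha 0.
  have ln2 : 0 < ln 2 :> R by rewrite ln_gt0// ltr1n.
  exists (1 + (ln 2)^-1); first by have : 0 < (ln 2)^-1 :> R by [rewrite invr_gt0]; lra.
  move=> N N2; rewrite mulr0.
  apply: le_trans (power_sum0_le _) _; first exact: ltn_trans N2.
  rewrite mulrDl mul1r addrC lerD2l ler_pdivlMl// mulr1.
  by rewrite ler_ln ?posrE ?ler_nat ?ltr0n//; exact: ltn_trans N2.
have p0 : 0 < 2 * alpha by rewrite mulr_gt0// lt_def ane0.
exists ((1 + 2 * alpha) / (2 * alpha)); first by rewrite divr_gt0//; lra.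
move=> N N2; have := power_sum_le N p0.
rewrite mulrAC ler_pdivrMr; last lra.
by move=> H; rewrite mulrAC ler_pdivlMr// mulrC [leRHS]mulrC.
Qed.

(** The sum stops at the integer part of N / 2 because the square of that
    half-side fits inside the disk of radius N. *)
Lemma power_sum_growth_ge (alpha : R) : 0 <= alpha < 1 ->
  exists2 c : R, 0 < c &
    forall N : nat, (2 <= N)%N ->
      c * growth_rate alpha N <= power_sum (2 * alpha) N./2.
Proof.
move=> /andP[a0 a1]; rewrite /growth_rate; have [->|ane0] := eqVneq alpha 0.
  exists 2^-1; first by rewrite invr_gt0.
  move=> N N2; rewrite mulr0.
  apply: le_trans (power_sum0_ge _).
  have N0 : (0 < N)%N by exact: ltn_trans N2.
  rewrite ler_pdivrMl// mulr_natl -lnXn ?ltr0n// ler_ln ?posrE ?exprn_gt0 ?ltr0n//.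
  (* N <= (M + 1)^2 for M the integer part of N / 2 *)
  rewrite -natrX ler_nat.
  have := odd_double_half N; rewrite -mul2n => {1}<-; case: (odd N); nia.
have p0 : 0 < 2 * alpha by rewrite mulr_gt0// lt_def ane0.
have c0 : 0 < 3^-1 `^ (2 * alpha) :> R by rewrite powR_gt0// invr_gt0.
exists (2^-1 * 3^-1 `^ (2 * alpha)); first by rewrite mulr_gt0 ?invr_gt0.
move=> N N2; rewrite -mulrA -powRM ?invr_ge0// ler_pdivrMl//.
apply: le_trans (power_sum_ge _ _); last by apply/andP; split; lra.
apply: ge0_ler_powR; rewrite ?nnegrE ?mulr_ge0 ?invr_ge0//.
(* the constant 1/3 comes from N <= 3 M for M the integer part of N / 2 *)
rewrite ler_pdivrMl// -natrM ler_nat.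
by have := odd_double_half N; rewrite -mul2n => {1}<-; case: (odd N) (odd_double_half N) N2
  => /=; lia.
Qed.

End PowerSums.

(** * Lattice sums over the low modes *)

Section LatticeSums.
Context {R : realType}.

(** Splitting by the sign turns a sum over this range into two sums over
    natural numbers. *)
Definition int_range (N : nat) : seq int :=
  [seq Posz i | i <- iota 0 N.+1] ++ [seq Negz i | i <- iota 0 N].

Definition int_box (N : nat) : seq (int * int) :=
  [seq (i, j) | i <- int_range N, j <- int_range N].

Lemma mem_int_range N i : (i \in int_range N) = (`|i| <= N)%N.
Proof.
rewrite /int_range mem_cat; case: i => i.
- rewrite mem_map; last by move=> ? ? [].
  rewrite mem_iota /= add0n ltnS orbC; case: mapP => // -[? _ //].
- rewrite orbC mem_map; last by move=> ? ? [].
  suff /negbTE -> : Negz i \notin [seq Posz j | j <- iota 0 N.+1] by rewrite orbF mem_iota.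
  by apply/mapP => -[].
Qed.

Lemma uniq_int_range N : uniq (int_range N).
Proof.
rewrite /int_range cat_uniq !map_inj_uniq ?iota_uniq//=; [|by move=> ? ? []..].
by rewrite andbT; apply/hasPn => _ /mapP[i _ ->]; apply/mapP => -[].
Qed.

Lemma mem_int_box N (k : int * int) :
  (k \in int_box N) = (`|k.1| <= N)%N && (`|k.2| <= N)%N.
Proof.
case: k => i j; apply/allpairsP/idP => /= [[[i' j'] /= [+ + [-> ->]]]|/andP[iN jN]].
  by rewrite !mem_int_range => -> ->.
by exists (i, j); rewrite !mem_int_range.
Qed.

Lemma uniq_int_box N : uniq (int_box N).
Proof. by apply: allpairs_uniq => [||[? ?] [? ?]]; rewrite ?uniq_int_range. Qed.

(** Each absolute value is attained by at most two integers. *)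
Lemma sum_int_range_le (f : nat -> R) N : (forall i, 0 <= f i) ->
  \sum_(i <- int_range N) f `|i|%N <= 2 * \sum_(0 <= i < N.+1) f i.
Proof.
move=> f0; rewrite big_cat !big_map/= mulrDl !mul1r.
apply: lerD; first by rewrite /index_iota subn0.
rewrite [leRHS]big_nat_recl//= ler_wpDl//.
by rewrite /index_iota subn0.
Qed.

Lemma sum_int_range_ge (f : int -> R) N : (forall i, 0 <= f i) ->
  \sum_(0 <= i < N.+1) f i%:Z <= \sum_(i <- int_range N) f i.
Proof.
move=> f0; rewrite big_cat !big_map/= /index_iota subn0 lerDl.
by apply: sumr_ge0.
Qed.

Lemma mode_norm_sqr (k : int * int) :
  @mode_norm R k ^+ 2 = (`|k.1| ^ 2 + `|k.2| ^ 2)%N%:R.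
Proof.
rewrite /mode_norm sqr_sqrtr ?addr_ge0 ?sqr_ge0//.
by rewrite natrD !natrX !natr_absz !intr_norm !real_normK ?num_real.
Qed.

Lemma mode_norm_ge0 (k : int * int) : 0 <= @mode_norm R k.
Proof. exact: sqrtr_ge0. Qed.

Lemma mode_norm_eq0 (k : int * int) : (@mode_norm R k == 0) = (k == 0).
Proof.
rewrite -sqrf_eq0 mode_norm_sqr pnatr_eq0 addn_eq0 !expn_eq0/= !andbT !absz_eq0.
by case: k.
Qed.

Definition low_modes (N : nat) : set (int * int) :=
  [set k | 0 < @mode_norm R k <= N%:R].

Lemma low_modesE N k : low_modes N k <->
  (k != 0) && (`|k.1| ^ 2 + `|k.2| ^ 2 <= N ^ 2)%N.
Proof.
rewrite /low_modes /= lt_def mode_norm_ge0 andbT mode_norm_eq0.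
have M0 := mode_norm_ge0 k.
by rewrite -(@ler_nat R) -mode_norm_sqr natrX ler_sqr ?nnegrE.
Qed.

(** An explicit enumeration, so that the finitely supported sums over
    [low_modes] become ordinary iterated sums. *)
Definition low_mode_seq N : seq (int * int) :=
  [seq k <- int_box N | k \in low_modes N].

Lemma mem_low_mode_seq N k : (k \in low_mode_seq N) = (k \in low_modes N).
Proof.
rewrite mem_filter mem_int_box andbC; apply/idP/idP => [/andP[]//|kN].
rewrite kN andbT; move: kN; rewrite inE => /low_modesE/andP[_].
by case: k => i j /=; apply/contraTT; rewrite negb_and -!ltnNge => /orP[]; nia.
Qed.

Lemma uniq_low_mode_seq N : uniq (low_mode_seq N).
Proof. by rewrite filter_uniq// uniq_int_box. Qed.

Lemma low_modes_seqE N : low_modes N = [set` low_mode_seq N].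
Proof. by apply/seteqP; split=> k /=; rewrite mem_low_mode_seq inE. Qed.

(** The four quadrants contribute at most as much as the first one each. *)
Lemma sum_low_mode_le (F : nat -> nat -> R) N : (forall i j, 0 <= F i j) ->
  \sum_(k <- low_mode_seq N) F `|k.1|%N `|k.2|%N <=
  4 * \sum_(0 <= i < N.+1) \sum_(0 <= j < N.+1)
    if (i == 0%N) && (j == 0%N) then 0 else F i j.
Proof.
move=> F0; pose G i j := if (i == 0%N) && (j == 0%N) then 0 else F i j.
have G0 i j : 0 <= G i j by rewrite /G; case: ifP.
apply: (@le_trans _ _ (\sum_(k <- int_box N) G `|k.1|%N `|k.2|%N)).
  rewrite big_filter big_mkcond/=; apply: ler_sum => k _; case: ifPn => //.
  rewrite inE => /low_modesE/andP[k0 _]; rewrite /G !absz_eq0.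
  by move: k0; rewrite -pair_eqE; case: k => ? ? /= /negbTE ->.
rewrite big_allpairs/=.
apply: (@le_trans _ _
  (\sum_(i <- int_range N) 2 * \sum_(0 <= j < N.+1) G `|i|%N j)).
  by apply: ler_sum => i _; exact: (sum_int_range_le (f := G `|i|%N)).
rewrite -mulr_sumr (_ : 4 = 2 * 2) -?mulrA ?ler_pM2l//; last by ring.
apply: (sum_int_range_le (f := fun i => \sum_(0 <= j < N.+1) G i j)) => i.
exact: sumr_ge0.
Qed.

(** The term of a nonzero pair (i, j) is at most a^(2 alpha - 2), a being the
    larger coordinate, and at most 2 (a + 1) <= 4 a pairs of natural numbers
    have larger coordinate a. *)
Lemma low_mode_sum_le (alpha : R) N : 0 <= alpha < 1 ->
  \sum_(k <- low_mode_seq N) (@mode_norm R k ^+ 2) `^ (alpha - 1) <=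
  16 * power_sum (2 * alpha) N.
Proof.
move=> /andP[a0 a1].
pose F i j : R := ((i ^ 2 + j ^ 2)%N%:R) `^ (alpha - 1).
pose g i : R := i%:R `^ (2 * alpha - 2).
under eq_bigr do rewrite mode_norm_sqr.
apply: le_trans (sum_low_mode_le (F := F) N _) _ => [i j|]; first exact: powR_ge0.
have -> : 16 = 4 * 4 :> R by ring.
rewrite -mulrA ler_pM2l//.
have gle i j : (0 < i)%N -> (j <= i)%N -> F i j <= g i.
  move=> i0 ji; rewrite /g (_ : 2 * alpha - 2 = 2 * (alpha - 1)); last by ring.
  rewrite powRrM (powR_mulrn 2)// -natrX /F -(opprB 1) !powRN.
  rewrite lef_pV2 ?posrE ?powR_gt0 ?ltr0n ?addn_gt0 ?expn_gt0 ?i0//.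
  by apply: ge0_ler_powR; rewrite ?nnegrE ?subr_ge0 ?(ltW a1)// ler_nat leq_addr.
have FC i j : F i j = F j i by rewrite /F addnC.
have gg : \sum_(1 <= i < N.+1) \sum_(0 <= j < i.+1) g i <=
          2 * power_sum (2 * alpha) N.
  rewrite /power_sum mulr_sumr; apply: ler_sum_nat => i /andP[i0 _].
  rewrite sumr_const_nat subn0 -[leLHS]mulr_natl.
  rewrite (_ : g i = i%:R `^ (2 * alpha - 1) / i%:R); last first.
    rewrite/g (_ : 2 * alpha - 2 = 2 * alpha - 1 - 1); last by ring.
    rewrite powRB ?powRr1//.
    by apply/implyP => _; rewrite pnatr_eq0 -lt0n.
  rewrite mulrCA [leRHS]mulrC ler_wpM2l ?powR_ge0//.
  by rewrite ler_pdivrMr ?ltr0n// -natrM ler_nat; lia.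
apply: (@le_trans _ _ (2 * (\sum_(1 <= i < N.+1) \sum_(0 <= j < i.+1) g i))); last first.
  have -> : 4 = 2 * 2 :> R by ring.
  by rewrite -mulrA ler_pM2l.
(* H i j charges the pair to its first coordinate when that is the larger
   one; H j i treats the opposite case. *)
pose H i j : R := if (0 < i)%N && (j <= i)%N then g i else 0.
have H0 i j : 0 <= H i j by rewrite /H; case: ifP => // _; exact: powR_ge0.
have HE : \sum_(0 <= i < N.+1) \sum_(0 <= j < N.+1) H i j =
          \sum_(1 <= i < N.+1) \sum_(0 <= j < i.+1) g i.
  rewrite big_nat_recl// /= big1_seq ?add0r; last by move=> j _; rewrite /H.
  rewrite [RHS]big_add1/= big_nat [RHS]big_nat; apply: eq_bigr => i /andP[_ iN].
  rewrite /H/= -big_mkcond/= [RHS](big_nat_widen _ _ N.+1)//.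
rewrite -HE mulrDl mul1r [X in _ <= _ + X]exchange_big/= -big_split/=.
apply: ler_sum => i _; rewrite -big_split/=; apply: ler_sum => j _.
case: ifPn => [_|]; first by rewrite addr_ge0.
rewrite negb_and -!lt0n => ij0.
have [ji|/ltnW ji] := leqP j i.
  have i0 : (0 < i)%N by move: ij0 ji; case: i => //= /leq_trans h /h.
  by rewrite ler_wpDr// /H i0 ji gle.
have j0 : (0 < j)%N by move: ij0; rewrite orbC => /orP[//|i0]; exact: leq_trans ji.
by rewrite ler_wpDl// /H j0 ji FC gle.
Qed.

(** Only the pairs 1 <= j <= i <= N / 2 are kept.  They belong to the disk of
    radius N, their terms are at least
    (2 i^2)^(alpha - 1) >= i^(2 alpha - 2) / 2, and there are i of them for
    each i. *)
Lemma low_mode_sum_ge (alpha : R) N : 0 <= alpha < 1 ->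
  2^-1 * power_sum (2 * alpha) N./2 <=
  \sum_(k <- low_mode_seq N) (@mode_norm R k ^+ 2) `^ (alpha - 1).
Proof.
move=> /andP[a0 a1].
pose F i j : R := ((i ^ 2 + j ^ 2)%N%:R) `^ (alpha - 1).
under [leRHS]eq_bigr do rewrite mode_norm_sqr.
pose G (k : int * int) : R := if k \in low_modes N then F `|k.1|%N `|k.2|%N else 0.
have G0 k : 0 <= G k by rewrite /G; case: ifP => // _; exact: powR_ge0.
have -> : \sum_(k <- low_mode_seq N) F `|k.1|%N `|k.2|%N = \sum_(k <- int_box N) G k.
  by rewrite big_filter big_mkcond.
rewrite big_allpairs/=.
pose h (i : int) := \sum_(0 <= j < N.+1) G (i, j%:Z).
apply: (@le_trans _ _ (\sum_(i <- int_range N) h i)); last first.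
  apply: ler_sum => i _; exact: (sum_int_range_ge (f := fun j => G (i, j))).
apply: le_trans (sum_int_range_ge (f := h) N _); last first.
  by move=> i; apply: sumr_ge0.
have N2 : (N./2 <= N)%N by rewrite -{2}(odd_double_half N); lia.
rewrite [leRHS](@big_cat_nat _ _ _ N./2.+1)//= ler_wpDr//.
  by apply: sumr_ge0 => i _; apply: sumr_ge0.
rewrite [leRHS]big_nat_recl//= ler_wpDl//; first exact: sumr_ge0.
rewrite /power_sum big_add1/= mulr_sumr.
apply: ler_sum_nat => i /andP[_ iN].
rewrite /h (@big_cat_nat _ _ _ i.+2)//=; last by lia.
rewrite ler_wpDr//; first by apply: sumr_ge0.
rewrite big_nat_recl//= ler_wpDl//.
apply: (@le_trans _ _ (\sum_(0 <= j < i.+1) (2 * i.+1%:R ^+ 2) `^ (alpha - 1))).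
  rewrite sumr_const_nat subn0 -[leRHS]mulr_natl powRM// -(powR_mulrn 2)// -powRrM.
  rewrite mulrCA; apply: ler_pM; rewrite ?invr_ge0 ?powR_ge0//.
    rewrite -powR_inv1//; apply: ler_powR; [by rewrite ler1n|lra].
  rewrite (_ : 2 * (alpha - 1) = 2 * alpha - 1 - 1); last by ring.
  by rewrite [in leRHS]powRB ?pnatr_eq0 ?implybT// powRr1// mulrCA divff ?mulr1// pnatr_eq0.
apply: ler_sum_nat => j /andP[_ ji].
have N2' := odd_double_half N; rewrite -mul2n in N2'.
rewrite /G ifT/=; last first.
  by rewrite inE; apply/low_modesE; rewrite -pair_eqE /=; nia.
rewrite /F -(opprB 1) !powRN lef_pV2 ?posrE ?powR_gt0 ?ltr0n ?addn_gt0 ?expn_gt0//.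
apply: ge0_ler_powR; rewrite ?nnegrE ?subr_ge0 ?(ltW a1) ?mulr_ge0 ?exprn_ge0//.
by rewrite -natrX -natrM ler_nat; nia.
Qed.

End LatticeSums.

(** * Densities and the variance of a Gaussian *)

Section Density.
Local Open Scope ereal_scope.
Context {d : measure_display} {T : measurableType d} {R : realType}.
Variables (mu nu : {measure set T -> \bar R}) (g : T -> R).
Hypotheses (mg : measurable_fun setT g) (g0 : forall x, (0 <= g x)%R).
Hypothesis nuE : forall A, measurable A -> nu A = \int[mu]_(x in A) (g x)%:E.

Import HBNNSimple.

Let integral_density_nnsfun (h : {nnsfun T >-> R}) :
  \int[nu]_x (h x)%:E = \int[mu]_x ((h x)%:E * (g x)%:E).
Proof.
under [LHS]eq_integral do rewrite fimfunE -fsumEFin//.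
rewrite [LHS]ge0_integral_fsum//; last 2 first.
  - by move=> r; exact/measurable_EFinP/measurableT_comp.
  - by move=> n x _; rewrite EFinM nnfun_muleindic_ge0.
transitivity (\int[mu]_x (\sum_(r \in range h)
    r%:E * ((\1_(h @^-1` [set r]) x)%:E * (g x)%:E))); last first.
  apply: eq_integral => x _; rewrite fimfunE -fsumEFin// muleC.
  rewrite ge0_mule_fsumr; last by move=> r; rewrite EFinM nnfun_muleindic_ge0.
  by apply: eq_fsbigr => r _; rewrite EFinM [RHS]muleC muleA.
rewrite ge0_integral_fsum//; last 2 first.
  - move=> r; apply: emeasurable_funM => //; apply: emeasurable_funM => //.
      exact/measurable_EFinP.
    exact/measurable_EFinP.
  - by move=> r x _; rewrite muleA mule_ge0 ?nnfun_muleindic_ge0// lee_fin.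
apply: eq_fsbigr => r _.
have [r0|r0] := ltP r 0%R.
  by rewrite (preimage_nnfun0 _ r0) indic0 !integral0_eq// => x _; rewrite ?mulr0 ?mul0e ?mule0.
rewrite ge0_integralZl_EFin//; last 2 first.
  - by move=> x _; rewrite mule_ge0 ?lee_fin.
  - by apply: emeasurable_funM; exact/measurable_EFinP.
rewrite integralZl_indic_nnsfun//; congr *%E.
rewrite integral_indic// setIT nuE// integral_mkcond.
by apply: eq_integral => x _; rewrite epatch_indic muleC.
Qed.

(** Both sides agree on indicators by hypothesis, hence on nonnegative simple
    functions, and the monotone convergence theorem extends this to all
    nonnegative measurable functions. *)
Lemma ge0_integral_density (f : T -> \bar R) : measurable_fun setT f ->
  (forall x, 0 <= f x) -> \int[nu]_x f x = \int[mu]_x (f x * (g x)%:E).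
Proof.
move=> mf f0; pose f_ := nnsfun_approx measurableT mf.
transitivity (limn (fun n => \int[nu]_x (f_ n x)%:E)).
  rewrite -monotone_convergence//=.
  - apply: eq_integral => x _; apply/esym/cvg_lim => //=.
    exact: cvg_nnsfun_approx.
  - by move=> n; exact/measurable_EFinP/measurable_funTS.
  - by move=> n x _; rewrite lee_fin.
  - by move=> x _ a b ab; rewrite lee_fin//; exact/lefP/nd_nnsfun_approx.
rewrite (_ : \int[mu]_x _ =
    limn (fun n => \int[mu]_x ((f_ n x)%:E * (g x)%:E))); last first.
  rewrite -monotone_convergence//=.
  - apply: eq_integral => x _; apply/esym/cvg_lim => //.
    by apply: cvgeZr => //; exact: cvg_nnsfun_approx.
  - by move=> n; apply: emeasurable_funM; exact/measurable_EFinP/measurable_funTS.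
  - by move=> n x _; rewrite mule_ge0 ?lee_fin.
  - move=> x _ a b ab; rewrite lee_wpmul2r ?lee_fin//.
    exact/lefP/nd_nnsfun_approx.
by congr (limn _); apply/funext => n; exact: integral_density_nnsfun.
Qed.

End Density.

Section GaussianVariance.
Context {R : realType}.
Variable s : R.
Hypothesis s0 : s != 0.
Local Notation mu := (@lebesgue_measure R).
Local Notation phi := (normal_pdf 0 s).

Lemma is_derive_normal_pdf (x : R) :
  is_derive x 1 phi (- (x / s ^+ 2) * phi x).
Proof.
rewrite normal_pdfE//= /normal_fun.
have h : is_derive x 1 (fun y : R^o => - (y - 0) ^+ 2 / (s ^+ 2 *+ 2) : R^o)
    (- (x / s ^+ 2)).
  apply: is_derive_eq; rewrite /GRing.scale/=.
  by field.
have := is_derive1_comp (is_derive_expR _) h => /(is_deriveZ (normal_peak s)).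
move=> H; apply: is_derive_eq H _; rewrite /GRing.scale/=; ring.
Qed.

(** The boundary term of the integration by parts below.  It vanishes because
    exp y >= y gives n phi(n) = O(1 / n). *)
Lemma cvg_x_normal_pdf : n%:R * phi n%:R @[n --> \oo] --> 0.
Proof.
have p0 := normal_peak_gt0 s0.
have s2 : 0 < s ^+ 2 by rewrite exprn_even_gt0.
apply: (@squeeze_cvgr _ _ _ _ (fun=> 0)
  (fun n => (2 * s ^+ 2 * normal_peak s * 2) * harmonic n)).
- near=> n; have n0 : 0 < n%:R :> R by rewrite ltr0n; near: n; exists 1%N.
  rewrite mulr_ge0 ?normal_pdf_ge0//= normal_pdfE// /normal_fun subr0 mulNr expRN.
  set y := _ / (_ *+ 2); have y0 : 0 < y by rewrite divr_gt0// ?exprn_gt0// pmulrn_lgt0.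
  apply: (@le_trans _ _ (n%:R * (normal_peak s * y^-1))).
    rewrite !ler_wpM2l ?(ltW n0) ?(ltW p0)// lef_pV2 ?posrE ?expR_gt0//.
    by apply: le_trans (expR_ge1Dx _); lra.
  rewrite /y invf_div -(mulr_natr (s ^+ 2)).
  have -> : n%:R * (normal_peak s * (s ^+ 2 * 2 / n%:R ^+ 2)) =
     2 * s ^+ 2 * normal_peak s * n%:R^-1 by field; rewrite gt_eqF.
  have C0 : 0 <= 2 * s ^+ 2 * normal_peak s by rewrite mulr_ge0 ?(ltW p0)// mulr_ge0// ltW.
  (* the factor 2 absorbs the shift of index: 1 / n <= 2 / (n + 1) *)
  rewrite /harmonic -[leRHS]mulrA ler_wpM2l//.
  rewrite ler_pdivlMr ?ltr0n// mulrC ler_pdivrMr// -natrM ler_nat.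
  by rewrite mul2n -addnn -addn1 leq_add2l -(ltr0n R).
- exact: cvg_cst.
- rewrite -[X in _ --> X](mulr0 (2 * s ^+ 2 * normal_peak s * 2)).
  by apply: cvgM; [exact: cvg_cst|exact: cvg_harmonic].
Unshelve. all: by end_near. Qed.

(** Integration by parts of x times x phi(x), the latter being the derivative
    of - s^2 phi(x), on [0, n]; then n tends to infinity, and evenness of the
    density doubles the integral over the half-line. *)
Lemma integral_normal_pdf_sqr :
  (\int[mu]_x (x ^+ 2 * phi x)%:E = (s ^+ 2)%:E)%E.
Proof.
have cphi : continuous phi by exact: continuous_normal_pdf.
have mphi := measurable_normal_pdf (0 : R) s.
have cxphi : continuous (fun x : R^o => x * phi x : R^o).
  by move=> x; apply: cvgM; [exact: cvg_id|exact: cphi].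
have cx2phi : continuous (fun x : R^o => x ^+ 2 * phi x : R^o).
  by move=> x; apply: cvgM; [exact: exprn_continuous|exact: cphi].
have even_phi x : phi (- x) = phi x.
  by rewrite normal_pdfE//= /normal_fun !subr0 sqrrN.
have half (f : R -> R) : (forall x, 0 <= f x) -> continuous f -> f =1 f \o -%R ->
    (\int[mu]_x (f x)%:E = 2%:E * \int[mu]_(x in `[0%R, +oo[) (f x)%:E)%E.
  by move=> f0 cf fN; rewrite ge0_symfun_integralT// set_itvcy.
have by_parts n : (\int[mu]_(x in `[0%R, n%:R]) (x ^+ 2 * phi x)%:E =
    (- s ^+ 2 * (n%:R * phi n%:R))%:E +
    (s ^+ 2)%:E * \int[mu]_(x in `[0%R, n%:R]) (phi x)%:E)%E.
  case: n => [|n]; first by rewrite set_itv1 !integral_set1 mul0r !mulr0 mule0 adde0.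
  have := @integration_by_parts R id (fun x => - s ^+ 2 * phi x) (cst 1)
    (fun x => x * phi x) 0 n.+1%:R.
  rewrite mul0r subr0 => H.
  under eq_integral do rewrite expr2 -mulrA.
  rewrite H ?ltr0n//.
  - rewrite mulrCA mulrA; congr (_ + _)%E.
    under eq_integral do rewrite mul1r EFinM.
    rewrite integralZl//; first by rewrite EFinN mulNe oppeK.
    by apply: (integrableS _ _ (@subsetT _ _)) => //; exact: integrable_normal_pdf.
  - exact/continuous_subspaceT/cst_continuous.
  - by split => [x _||]; [exact: derivable_id|
      exact/cvg_at_right_filter/cvg_id|exact/cvg_at_left_filter/cvg_id].
  - by move=> x _; rewrite derive1E derive_id.
  - exact: continuous_subspaceT.
  - split => [x _||].
    + apply: derivableM; first exact: derivable_cst.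
      by have [] := is_derive_normal_pdf x.
    + by apply: cvg_at_right_filter; apply: cvgM; [exact: cvg_cst|exact: cphi].
    + by apply: cvg_at_left_filter; apply: cvgM; [exact: cvg_cst|exact: cphi].
  - move=> x _; rewrite derive1E.
    have [_ D] := is_deriveZ (- s ^+ 2) (is_derive_normal_pdf x).
    by rewrite -[LHS]/('D_1 (- s ^+ 2 \*: phi) x) D /GRing.scale/=; field.
have lim1 : (\int[mu]_(x in `[0%R, n%:R]) (x ^+ 2 * phi x)%:E @[n --> \oo] -->
    \int[mu]_(x in `[0%R, +oo[) (x ^+ 2 * phi x)%:E)%E.
  apply: ge0_cvgn_integral => [x|].
    by rewrite mulr_ge0 ?sqr_ge0 ?normal_pdf_ge0.
  exact: continuous_measurable_fun.
have lim2 : (\int[mu]_(x in `[0%R, n%:R]) (x ^+ 2 * phi x)%:E @[n --> \oo] -->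
    (- s ^+ 2 * 0)%:E + (s ^+ 2)%:E * \int[mu]_(x in `[0%R, +oo[) (phi x)%:E)%E.
  under eq_fun do rewrite by_parts.
  apply: cvgeD; first by rewrite mulr0 fin_num_adde_defr.
    by apply: cvg_EFin; [exact: nearW|apply: cvgM; [exact: cvg_cst|exact: cvg_x_normal_pdf]].
  apply: cvgeZl => //; apply: ge0_cvgn_integral => [x|//].
  exact: normal_pdf_ge0.
rewrite half//; [|by move=> x; rewrite mulr_ge0 ?sqr_ge0 ?normal_pdf_ge0|
  by move=> x /=; rewrite sqrrN even_phi].
rewrite (cvg_unique _ lim1 lim2)// mulr0 add0e muleCA.
rewrite -half ?integral_normal_pdf ?mule1// => x; first exact: normal_pdf_ge0.
by rewrite /= even_phi.
Qed.

Lemma normal_prob_second_moment :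
  (\int[normal_prob 0 s]_x (x ^+ 2)%:E = (s ^+ 2)%:E)%E.
Proof.
rewrite (@ge0_integral_density _ _ _ mu _ phi)//.
- by under eq_integral do rewrite -EFinM; exact: integral_normal_pdf_sqr.
- exact: measurable_normal_pdf.
- by move=> x; exact: normal_pdf_ge0.
- exact/measurable_EFinP/measurable_funX.
- by move=> x; rewrite lee_fin sqr_ge0.
Qed.

End GaussianVariance.

(** * Square-integrable functions *)

Section SquareIntegrable.
Context {d : measure_display} {T : measurableType d} {R : realType}.
Variables (mu : {measure set T -> \bar R}) (D : set T).
Hypothesis mD : measurable D.
Local Notation normsq f := (\int[mu]_(x in D) ((f x) ^+ 2)%R%:E)%E.

Lemma integrable_mul_sqr (f g : T -> R) :
  measurable_fun D f -> measurable_fun D g ->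
  (normsq f < +oo)%E -> (normsq g < +oo)%E ->
  mu.-integrable D (fun x => (f x * g x)%:E).
Proof.
move=> mf mg foo goo.
have sqr_integrable (h : T -> R) : measurable_fun D h -> (normsq h < +oo)%E ->
    mu.-integrable D (fun x => (h x ^+ 2)%:E).
  move=> mh hoo; apply/integrableP; split.
    exact/measurable_EFinP/measurable_funX.
  by under eq_integral do rewrite abse_EFin ger0_norm ?sqr_ge0//.
apply: (le_integrable mD _ _
  (integrableD mD (sqr_integrable _ mf foo) (sqr_integrable _ mg goo))).
  exact/measurable_EFinP/measurable_funM.
move=> x Dx; rewrite -EFinD !abse_EFin lee_fin.
rewrite [leRHS]ger0_norm ?addr_ge0 ?sqr_ge0// ler_norml.
have := sqr_ge0 (f x - g x); have := sqr_ge0 (f x + g x).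
have := sqr_ge0 (f x); have := sqr_ge0 (g x).
rewrite sqrrD sqrrB; lra.
Qed.

(** Pythagoras. *)
Lemma integral_sqr_orthogonal (I : finType) (a v : I -> R) (f : I -> T -> R) :
  (forall i, measurable_fun D (f i)) ->
  (forall i j, \int[mu]_(x in D) (f i x * f j x)%:E = (v i *+ (i == j))%:E)%E ->
  normsq (fun x => \sum_i a i * f i x) = (\sum_i a i ^+ 2 * v i)%:E.
Proof.
move=> mf fE.
have fint i j : mu.-integrable D (fun x => (f i x * f j x)%:E).
  have fin k : (normsq (f k) < +oo)%E.
    by under eq_integral do rewrite expr2; rewrite fE eqxx ltry.
  exact: integrable_mul_sqr.
transitivity (\int[mu]_(x in D)
    \sum_i \sum_j (a i * a j)%:E * (f i x * f j x)%:E)%E.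
  apply: eq_integral => x _; rewrite expr2 big_distrlr/= -sumEFin.
  apply: eq_bigr => i _; rewrite -sumEFin; apply: eq_bigr => j _.
  by rewrite -EFinM mulrACA.
rewrite integral_sum//; last first.
  by move=> i; apply: integrable_sum => // j _; exact: integrableZl.
rewrite -sumEFin; apply: eq_bigr => i _.
rewrite integral_sum//; last by move=> j; exact: integrableZl.
rewrite (bigD1 i)//= big1 ?adde0.
  by rewrite integralZl// fE eqxx -EFinM expr2.
by move=> j ji; rewrite integralZl// fE eq_sym (negbTE ji) mule0.
Qed.

(** Minkowski's inequality in a form that needs no square root: the difference
    of the two integrands is e^-1 times the square of e v - (u - v). *)
Lemma normsq_le_young (u v : T -> R) (e : R) : 0 < e ->
  measurable_fun D u -> measurable_fun D v ->
  (normsq u <= (1 + e)%:E * normsq v +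
               (1 + e^-1)%:E * normsq (fun x => u x - v x)%R)%E.
Proof.
move=> e0 mu_ mv.
have ei0 : 0 < e^-1 by rewrite invr_gt0.
have mw : measurable_fun D (fun x => u x - v x) by exact: measurable_funB.
rewrite -!ge0_integralZl_EFin//; try by move=> x _; rewrite lee_fin sqr_ge0.
2-5: try exact/measurable_EFinP/measurable_funX; try lra.
rewrite -ge0_integralD//.
2-5: try (by move=> x _; rewrite mule_ge0 ?lee_fin ?sqr_ge0//; lra);
     apply/measurable_funeM/measurable_EFinP/measurable_funX => //.
apply: ge0_le_integral => //.
- by move=> x _; rewrite lee_fin sqr_ge0.
- exact/measurable_EFinP/measurable_funX.
- by apply: emeasurable_funD; apply/measurable_funeM/measurable_EFinP/measurable_funX.
- move=> x _; rewrite -!EFinM -EFinD lee_fin -subr_ge0.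
  set w := u x - v x.
  have -> : (1 + e) * v x ^+ 2 + (1 + e^-1) * w ^+ 2 - u x ^+ 2 =
    e^-1 * (e * v x - w) ^+ 2 by rewrite /w; field; rewrite gt_eqF.
  by rewrite mulr_ge0 ?sqr_ge0// ltW.
Qed.

End SquareIntegrable.

(** Lets the parameter of [normsq_le_young], applied twice, tend to 0. *)
Lemma lee_mul_sqr_add1 {R : realType} (a b : \bar R) : (0 <= b)%E ->
  (forall e : R, (0 < e)%R -> a <= ((1 + e) ^+ 2)%:E * b)%E -> (a <= b)%E.
Proof.
case: b => [b b0 ab|_ _|//]; last by rewrite leey.
rewrite lee_fin in b0.
apply/lee_addgt0Pr => e e0.
(* (1 + d)^2 <= 1 + 3 d for d <= 1 *)
pose d := Num.min 1 (e / (3 * b + 1)).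
have b1 : 0 < 3 * b + 1 by lra.
have d0 : 0 < d by rewrite lt_min ltr01/= divr_gt0.
apply: le_trans (ab d d0) _; rewrite -EFinM -EFinD lee_fin.
have d1 : d <= 1 by rewrite ge_min lexx.
have de : d * (3 * b + 1) <= e by rewrite -ler_pdivlMr// ge_min lexx orbT.
have : d ^+ 2 <= d by rewrite expr2 ler_piMr// ltW.
move=> /(ler_wpM2r b0); nra.
Qed.

Section L2Limits.
Context {d1 d2 : measure_display} {T1 : measurableType d1} {T2 : measurableType d2}.
Context {R : realType}.
Variables (mu1 : {measure set T1 -> \bar R}) (mu2 : {measure set T2 -> \bar R}).
Variables (D1 : set T1) (D2 : set T2).
Hypotheses (mD1 : measurable D1) (mD2 : measurable D2).

(** The norm of u is the limit of those of the approximations un, which are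
    the norms of the vn by assumption; the two sides may live on different
    measure spaces, which is how an isometry on a dense set extends. *)
Lemma normsq_limit_le (u : T1 -> R) (un : nat -> T1 -> R)
    (v : T2 -> R) (vn : nat -> T2 -> R) :
  measurable_fun D1 u -> (forall n, measurable_fun D1 (un n)) ->
  measurable_fun D2 v -> (forall n, measurable_fun D2 (vn n)) ->
  (forall n, \int[mu1]_(x in D1) ((un n x) ^+ 2)%:E =
             \int[mu2]_(x in D2) ((vn n x) ^+ 2)%:E)%E ->
  (\int[mu1]_(x in D1) ((u x - un n x) ^+ 2)%:E)%E @[n --> \oo] --> 0%E ->
  (\int[mu2]_(x in D2) ((v x - vn n x) ^+ 2)%:E)%E @[n --> \oo] --> 0%E ->
  (\int[mu1]_(x in D1) ((u x) ^+ 2)%:E <= \int[mu2]_(x in D2) ((v x) ^+ 2)%:E)%E.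
Proof.
move=> mu_ mun mv mvn unvn uun vvn.
have v0 : (0 <= \int[mu2]_(x in D2) ((v x) ^+ 2)%:E)%E.
  by apply: integral_ge0 => x _; rewrite lee_fin sqr_ge0.
apply: lee_mul_sqr_add1 => // e e0.
have [->|vfin] := eqVneq (\int[mu2]_(x in D2) ((v x) ^+ 2)%:E)%E +oo%E.
  by rewrite gt0_muley ?leey// lte_fin exprn_gt0// addr_gt0.
have {vfin} : (\int[mu2]_(x in D2) ((v x) ^+ 2)%:E)%E \is a fin_num.
  by rewrite ge0_fin_numE// ltey.
set b := (\int[mu2]_(x in D2) _)%E => bfin.
have e1 : 0 < 1 + e by rewrite addr_gt0.
have e2 : 0 < 1 + e^-1 by rewrite addr_gt0// invr_gt0.
have := @cvge_ge nat \oo _ R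
  (fun n => (1 + e)%:E * ((1 + e)%:E * b + (1 + e^-1)%:E *
      \int[mu2]_(x in D2) ((v x - vn n x) ^+ 2)%:E) +
    (1 + e^-1)%:E * \int[mu1]_(x in D1) ((u x - un n x) ^+ 2)%:E)%E
  ((1 + e)%:E * ((1 + e)%:E * b + (1 + e^-1)%:E * 0) + (1 + e^-1)%:E * 0)%E
  (\int[mu1]_(x in D1) ((u x) ^+ 2)%:E)%E.
rewrite !mule0 !adde0 muleA -EFinM -expr2; apply.
  near=> n.
  apply: le_trans (normsq_le_young mu1 mD1 e0 mu_ (mun n)) _.
  rewrite leeD2r// lee_pmul2l//= ?lte_fin//.
  rewrite unvn; apply: le_trans (normsq_le_young mu2 mD2 e0 (mvn n) mv) _.
  rewrite leeD2l// lee_pmul2l//= ?lte_fin//.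
  by under eq_integral do rewrite -sqrrN opprB.
have fin0 (x : \bar R) : (x \is a fin_num)%E -> (x +? (1 + e^-1)%:E * 0)%E.
  by move=> xfin; rewrite mule0 fin_num_adde_defl.
rewrite [X in _ --> X](_ : _ = (1 + e)%:E * ((1 + e)%:E * b + (1 + e^-1)%:E * 0) +
  (1 + e^-1)%:E * 0)%E; last by rewrite !mule0 !adde0 muleA -EFinM expr2.
apply: cvgeD.
- by apply: fin0; rewrite mule0 adde0 !fin_numM.
- apply: cvgeZl => //; apply: cvgeD; [by apply: fin0; rewrite fin_numM|exact: cvg_cst|].
  exact: cvgeZl.
- exact: cvgeZl.
Unshelve. all: by end_near. Qed.

End L2Limits.

(** * The Ito isometry *)

Section Ito.
Context {d : measure_display} {T : measurableType d} {R : realType}.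
Variable P : probability T R.
Variable B : R -> {RV P >-> R}.
Hypothesis bB : brownian_motion B.
Local Notation leb := (@lebesgue_measure R).

Lemma measurable_increment (s t : R) : measurable_fun setT (increment B s t).
Proof. exact: measurable_funB. Qed.

Lemma increment_second_moment (s t : R) : 0 <= s <= t ->
  (\int[P]_w (increment B s t w ^+ 2)%:E = (t - s)%:E)%E.
Proof.
case: bB => _ _ law _ /andP[s0]; rewrite le_eqVlt => /predU1P[<-|st].
  by rewrite subrr integral0_eq// => w _; rewrite /increment subrr expr0n.
have ts0 : 0 < t - s by rewrite subr_gt0.
have sq0 : Num.sqrt (t - s) != 0 by rewrite gt_eqF// sqrtr_gt0.
rewrite -[RHS]/((t - s)%:E) -[t - s]sqr_sqrtr ?(ltW ts0)//.
rewrite -normal_prob_second_moment//.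
have mi : @measurable_fun _ _ T (measurableTypeR R) setT (increment B s t).
  exact: measurable_increment.
pose X : {mfun T >-> measurableTypeR R} := HB.pack (increment B s t : T -> measurableTypeR R)
  (isMeasurableFun.Build _ _ _ _ _ mi).
transitivity (\int[pushforward P X]_x (x ^+ 2)%:E)%E.
  rewrite ge0_integral_pushforward//.
    exact/measurable_EFinP/measurable_funX.
  by move=> x _; rewrite lee_fin sqr_ge0.
apply: (@eq_measure_integral _ _ R setT (normal_prob 0 (Num.sqrt (t - s)))
  (pushforward P X)) => A mA _; exact: law.
Qed.

(** Polarization: if X, Y, Z are consecutive increments, then
    2 X Z = (X + Y + Z)^2 + Y^2 - (X + Y)^2 - (Y + Z)^2, and the four second
    moments are lengths of intervals whose alternating sum is zero. *)
Lemma increments_orthogonal (s t u v : R) : 0 <= s -> s <= t -> t <= u -> u <= v ->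
  (\int[P]_w (increment B s t w * increment B u v w)%:E = 0)%E.
Proof.
move=> s0 st tu uv.
have t0 := le_trans s0 st; have u0 := le_trans t0 tu.
have sq (a b : R) : 0 <= a -> a <= b ->
    P.-integrable setT (fun w => (increment B a b w ^+ 2)%:E).
  move=> a0 ab; under eq_fun do rewrite expr2.
  apply: integrable_mul_sqr => //; try exact: measurable_increment;
  by rewrite increment_second_moment ?a0//= ltry.
have sv : s <= v by lra. have su : s <= u by lra. have tv : t <= v by lra.
have := sq _ _ s0 sv; have := sq _ _ s0 su; have := sq _ _ t0 tv; have := sq _ _ t0 tu.
move=> itu itv isu isv.
transitivity (\int[P]_w ((2^-1)%:E *
   (((increment B s v w ^+ 2)%:E + (increment B t u w ^+ 2)%:E) -
    ((increment B s u w ^+ 2)%:E + (increment B t v w ^+ 2)%:E))))%E.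
  apply: eq_integral => w _; rewrite -!EFinD -EFinM /increment.
  by congr EFin; field.
have i1 := integrableD measurableT isv itu.
have i2 := integrableD measurableT isu itv.
rewrite integralZl//; last exact: integrableB.
rewrite integralB// !integralD// !increment_second_moment ?s0 ?t0//.
by rewrite -!EFinD -EFinM; congr EFin; ring.
Qed.

(** The increments of B and the indicators of the steps are orthogonal families
    with the same squared norms. *)
Lemma ito_isometry_step (t : R) (h : step_function t) :
  (\int[P]_w (step_integral B h w ^+ 2)%:E =
   \int[leb]_(s in `[0%R, t]) (step_eval h s ^+ 2)%:E)%E.
Proof.
case: h => n s a /= s0 sh st; rewrite /step_integral /step_eval/=.
have sge i : 0 <= s i by exact: le_trans s0 (sh _ _ (leq0n i)).
have sS i : s i <= s i.+1 by exact: sh.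
rewrite (@integral_sqr_orthogonal _ _ _ P _ measurableT _ _
  (fun i : 'I_n => s i.+1 - s i))//; first last.
- move=> i j; have [<-|ij] := eqVneq i j.
    by under eq_integral do rewrite -expr2; rewrite increment_second_moment ?sge ?sS.
  wlog : i j ij / (i < j)%N.
    move=> H; have [|ji] := ltnP i j; first exact: H.
    under eq_integral do rewrite mulrC.
    by apply: H; rewrite 1?eq_sym// ltn_neqAle ji andbT eq_sym.
  by move=> lij; rewrite increments_orthogonal// sh.
- by move=> i; exact: measurable_increment.
rewrite (@integral_sqr_orthogonal _ _ _ leb `[0%R, t]%classic _ _ _
  (fun i : 'I_n => s i.+1 - s i))//.
  by move=> i; exact/measurable_funTS/measurable_indic.
move=> i j.
transitivity (\int[leb]_(x in `[0%R, t])
   (\1_(`]s i, s i.+1] `&` `]s j, s j.+1]) x)%:E)%E.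
  by apply: eq_integral => x _; rewrite indicI.
rewrite integral_indic//; last exact: measurableI.
have [<-|ij] := eqVneq i j.
  rewrite setIid setIidl; last first.
    move=> x /=; rewrite !in_itv/= => /andP[sx xs]; apply/andP; split.
      by apply: ltW; exact: le_lt_trans sx.
    by apply: (le_trans xs); apply: le_trans st; exact: sh.
  rewrite [LHS](lebesgue_measure_itv `]s i, s i.+1])/= lte_fin; case: ltP => // ss.
  by congr EFin; apply/eqP; rewrite eq_sym subr_eq0 eq_le ss sS.
rewrite (_ : _ `&` _ = set0) ?measure0//.
apply/seteqP; split => // x /= [[]]; rewrite !in_itv/=.
wlog : i j ij / (i < j)%N.
  move=> H; have [|ji] := ltnP i j; first exact: H.
  by move=> A C; apply: (H j i) => //; rewrite 1?eq_sym// ltn_neqAle ji andbT eq_sym.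
move=> lij /andP[_ xi] /andP[xj _].
by have := le_lt_trans (sh _ _ lij) (lt_le_trans xj xi); rewrite ltxx.
Qed.

Lemma ito_isometry (t : R) (f : R -> R) (Y : {RV P >-> R}) :
  measurable_fun `[0, t] f -> wiener_integral B t f Y ->
  (\int[P]_w (Y w ^+ 2)%:E = \int[leb]_(s in `[0%R, t]) (f s ^+ 2)%:E)%E.
Proof.
move=> mf [h [hf hY]].
have mstep n : measurable_fun `[0, t] (step_eval (h n)).
  by apply: measurable_sum => i; apply: measurable_funM.
have mint n : measurable_fun setT (step_integral B (h n)).
  by apply: measurable_sum => i; apply: measurable_funM => //; exact: measurable_increment.
have iso n := ito_isometry_step (h n).
apply/eqP; rewrite eq_le; apply/andP; split.
  have := @normsq_limit_le _ _ _ _ R P leb setT `[0, t]%classic measurableT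
    (measurable_itv `[0, t]) _ _ _ _ (measurable_funP Y) mint mf mstep iso hY hf.
  exact.
have := @normsq_limit_le _ _ _ _ R leb P `[0, t]%classic setT
  (measurable_itv `[0, t]) measurableT _ _ _ _ mf mstep (measurable_funP Y) mint
  (fun n => esym (iso n)) hf hY.
exact.
Qed.

End Ito.

(** * Orthonormality of the torus basis *)

Section ProductIntegral.
Local Open Scope ereal_scope.
Context {d1 d2 : measure_display}.
Context {T1 : measurableType d1} {T2 : measurableType d2} {R : realType}.
Variables (m1 : {sigma_finite_measure set T1 -> \bar R}).
Variables (m2 : {sigma_finite_measure set T2 -> \bar R}).
Variables (D1 : set T1) (D2 : set T2) (f : T1 -> R) (g : T2 -> R).
Hypotheses (mD1 : measurable D1) (mD2 : measurable D2).
Hypotheses (intf : m1.-integrable D1 (EFin \o f)).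
Hypotheses (intg : m2.-integrable D2 (EFin \o g)).

Let F : T1 -> R := f \_ D1.
Let G : T2 -> R := g \_ D2.
Let h (x : T1 * T2) : \bar R := (F x.1 * G x.2)%:E.

Let intF : m1.-integrable setT (EFin \o F).
Proof. by rewrite -restrict_EFin; apply/integrable_restrict; rewrite ?setTI. Qed.

Let intG : m2.-integrable setT (EFin \o G).
Proof. by rewrite -restrict_EFin; apply/integrable_restrict; rewrite ?setTI. Qed.

Let mF : measurable_fun setT F.
Proof. by apply/measurable_EFinP; exact: measurable_int intF. Qed.

Let mG : measurable_fun setT G.
Proof. by apply/measurable_EFinP; exact: measurable_int intG. Qed.

Let mh : measurable_fun setT h.
Proof.
apply/measurable_EFinP; apply: measurable_funM.
  exact: measurableT_comp mF measurable_fst.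
exact: measurableT_comp mG measurable_snd.
Qed.

Let hE x y : h (x, y) = (F x)%:E * (G y)%:E.
Proof. by []. Qed.

Let inth : (m1 \x m2).-integrable setT h.
Proof.
apply/(integrable12ltyP m1 m2 mh).
under eq_integral => x _.
  under eq_integral do rewrite hE abseM.
  rewrite ge0_integralZl//; last first.
    by apply: measurableT_comp => //; exact/measurable_EFinP.
  over.
rewrite ge0_integralZr//; last 2 first.
  - by apply: measurableT_comp => //; exact/measurable_EFinP.
  - exact: integral_ge0.
by case/integrableP : intF => _ iF; case/integrableP : intG => _ iG;
  rewrite lte_mul_pinfty ?integral_ge0// ge0_fin_numE ?integral_ge0.
Qed.

Let restrict_setX :
  (fun x => (f x.1 * g x.2)%:E) \_ (D1 `*` D2) = h.
Proof.
apply/funext => -[x y]; rewrite /h /F /G /patch/=.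
have -> : ((x, y) \in D1 `*` D2) = (x \in D1) && (y \in D2).
  by apply/idP/andP; rewrite !inE => -[].
by case: (x \in D1); case: (y \in D2); rewrite ?mul0r ?mulr0.
Qed.

Lemma integrable_prod :
  (m1 \x m2).-integrable (D1 `*` D2) (fun x => (f x.1 * g x.2)%:E).
Proof.
have := inth; rewrite -restrict_setX => /(integrable_restrict _ _).
by rewrite setTI; apply => //; exact: measurableX.
Qed.

Lemma integral_prod :
  \int[m1 \x m2]_(x in D1 `*` D2) (f x.1 * g x.2)%:E =
  \int[m1]_(x in D1) (f x)%:E * \int[m2]_(y in D2) (g y)%:E.
Proof.
rewrite integral_mkcond restrict_setX -(integral12_prod_meas1 inth).
rewrite [in RHS](integral_mkcond D1) [in RHS](integral_mkcond D2).
rewrite (restrict_EFin f D1) (restrict_EFin g D2) -/F -/G.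
have -> : \int[m2]_y (EFin \o G) y = (fine (\int[m2]_y (EFin \o G) y))%:E.
  by rewrite fineK// integrable_fin_num.
under [LHS]eq_integral => x _.
  rewrite /fubini_F; under eq_integral do rewrite hE.
  rewrite integralZl// -[X in _ * X]fineK ?integrable_fin_num//; over.
by rewrite integralZr.
Qed.

End ProductIntegral.

Section TrigBasis.
Context {R : realType}.
Variable L : R.
Hypothesis L0 : 0 < L.
Local Notation leb := (@lebesgue_measure R).

(** The cosine for [true] and the sine for [false]; one family for both allows
    a uniform treatment of the products of two basis functions. *)
Definition trig (c : bool) (n : int) (z : R) : R :=
  (if c then cos else sin) (2 * pi * n%:~R * z / L).

Lemma sin_2pi_int (n : int) : sin (2 * pi * n%:~R) = 0 :> R.
Proof.
have nat_case (m : nat) : sin (2 * pi * m%:R) = 0 :> R.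
  rewrite mulr_natr (mulr_natl pi 2) -[X in sin X]add0r.
  by rewrite (periodicn (@sinD2pi R)) sin0.
case: n => n; first exact: nat_case.
by rewrite NegzE rmorphN mulrN sinN nat_case oppr0.
Qed.

Lemma cos_2pi_int (n : int) : cos (2 * pi * n%:~R) = 1 :> R.
Proof.
have nat_case (m : nat) : cos (2 * pi * m%:R) = 1 :> R.
  rewrite mulr_natr (mulr_natl pi 2) -[X in cos X]add0r.
  by rewrite (periodicn (@cosD2pi R)) cos0.
case: n => n; first exact: nat_case.
by rewrite NegzE rmorphN mulrN cosN nat_case.
Qed.

Lemma continuous_trig c n : continuous (trig c n).
Proof.
move=> z; apply: (@continuous_comp _ _ _ (fun z : R => 2 * pi * n%:~R * z / L)
  (if c then cos else sin)).
  apply: cvgM; last exact: cvg_cst.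
  by apply: cvgM; [exact: cvg_cst|exact: cvg_id].
by case: c; [exact: continuous_cos|exact: continuous_sin].
Qed.

Lemma continuous_integrable_period (f : R -> R) : continuous f ->
  leb.-integrable `[0, L] (EFin \o f).
Proof.
move=> cf; apply: continuous_compact_integrable; first exact: segment_compact.
exact: continuous_subspaceT.
Qed.

Lemma integral_trig c n :
  \int[leb]_(z in `[0, L]) trig c n z = if c && (n == 0) then L else 0.
Proof.
have [->|n0] := eqVneq n 0.
  have trig0 (z : R) : trig c 0 z = if c then 1 else 0.
    by rewrite /trig mulr0 !mul0r; case: c; rewrite ?cos0 ?sin0.
  under eq_Rintegral do rewrite trig0.
  rewrite andbT Rintegral_cst// (_ : fine _ = L); last first.
    by rewrite [X in fine X](lebesgue_measure_itv `[0, L])/= lte_fin L0 oppr0 adde0.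
  by case: (c); rewrite ?mul1r ?mul0r.
rewrite andbF.
pose a : R := 2 * pi * n%:~R / L.
have pi0 := pi_gt0 R.
have a0 : a != 0 by rewrite !mulf_neq0 ?invr_eq0 ?intr_eq0// gt_eqF.
(* a primitive, periodic of period L *)
pose F (z : R) : R := a^-1 * (if c then sin (a * z) else - cos (a * z)).
have aE z : 2 * pi * n%:~R * z / L = a * z by rewrite /a; field; rewrite gt_eqF.
have dF (z : R) : is_derive z 1 F (trig c n z).
  rewrite /trig aE /F; have ha : is_derive z 1 (fun y : R => a * y) a.
    by apply: is_derive_eq; rewrite /GRing.scale/= mulr1.
  case: (c).
  - have := is_deriveZ a^-1 (is_derive1_comp (is_derive_sin _) ha).
    by move=> H; apply: is_derive_eq H _; rewrite /GRing.scale/= mulrCA mulVf ?mulr1.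
  - have := is_deriveZ a^-1 (is_deriveN (is_derive1_comp (is_derive_cos _) ha)).
    by move=> H; apply: is_derive_eq H _; rewrite /GRing.scale/= mulNr opprK mulrCA mulVf ?mulr1.
have cF : continuous F.
  move=> z; apply: differentiable_continuous.
  by apply/derivable1_diffP; have [] := dF z.
rewrite /Rintegral (@continuous_FTC2 R _ F)//.
- have aL : a * L = 2 * pi * n%:~R by rewrite /a divfK// gt_eqF.
  by rewrite /F -EFinB/= aL mulr0; case: (c); rewrite ?sin_2pi_int ?cos_2pi_int ?sin0 ?cos0 subrr.
- exact/continuous_subspaceT/continuous_trig.
- split => [x _||]; first by have [] := dF x.
    exact/cvg_at_right_filter/cF.
  exact/cvg_at_left_filter/cF.
- by move=> x _; rewrite derive1E; have [_ ->] := dF x.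
Qed.

Lemma integral_trig2 (a b : R) c n c' n' :
  \int[leb]_(z in `[0, L]) (a * trig c n z + b * trig c' n' z) =
  a * (if c && (n == 0) then L else 0) + b * (if c' && (n' == 0) then L else 0).
Proof.
have int1 (x : R) c0 n0 : leb.-integrable `[0, L]
    (EFin \o (fun z => x * trig c0 n0 z)).
  apply: continuous_integrable_period => z.
  by apply: cvgM; [exact: cvg_cst|exact: continuous_trig].
have int0 c0 n0 : leb.-integrable `[0, L] (EFin \o trig c0 n0).
  by apply: continuous_integrable_period => z; exact: continuous_trig.
by rewrite RintegralD// !RintegralZl// !integral_trig.
Qed.

Lemma trigD c (i j : int) z : trig c (i + j) z =
  if c then trig true i z * trig true j z - trig false i z * trig false j z
  else trig false i z * trig true j z + trig true i z * trig false j z.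
Proof.
rewrite /trig rmorphD/=.
have -> : 2 * pi * (i%:~R + j%:~R) * z / L =
   2 * pi * i%:~R * z / L + 2 * pi * j%:~R * z / L by ring.
by case: c; rewrite ?cosD ?sinD.
Qed.

Lemma trigN c (i : int) z : trig c (- i) z = if c then trig c i z else - trig c i z.
Proof.
rewrite /trig rmorphN/=.
have -> : 2 * pi * (- i%:~R) * z / L = - (2 * pi * i%:~R * z / L) by ring.
by case: c; rewrite ?cosN ?sinN.
Qed.

Lemma omegaE (i : int) z : omega L i z =
  if i == 0 then 1 / Num.sqrt L else Num.sqrt (2 / L) * trig (i < 0) i z.
Proof.
rewrite /omega /trig; have [->|i0] := eqVneq i 0; first by rewrite ltxx.
by have [] := ltgtP i 0 => // ie; move: i0; rewrite ie eqxx.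
Qed.

Lemma continuous_omega i : continuous (omega L i).
Proof.
have -> : omega L i = fun z => if i == 0 then 1 / Num.sqrt L
    else Num.sqrt (2 / L) * trig (i < 0) i z by apply/funext => z; exact: omegaE.
case: eqP => _ z; first exact: cvg_cst.
by apply: cvgM; [exact: cvg_cst|exact: continuous_trig].
Qed.

(** The product-to-sum formulas write the product of the functions of indices
    i and j as a combination of the frequencies i + j and i - j, of which only
    the frequency 0 has a nonzero integral, and only as a cosine. *)
Lemma omega_orthonormal (i j : int) :
  \int[leb]_(z in `[0, L]) (omega L i z * omega L j z) = (i == j)%:R.
Proof.
have L_neq0 : L != 0 by rewrite gt_eqF.
have sL : Num.sqrt L != 0 by rewrite gt_eqF// sqrtr_gt0.
have sL2 : Num.sqrt L ^+ 2 = L by rewrite sqr_sqrtr// ltW.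
have s2 : Num.sqrt (2 / L) ^+ 2 = 2 / L by rewrite sqr_sqrtr// divr_ge0// ltW.
have constant_case k : \int[leb]_(z in `[0, L]) (omega L 0 z * omega L k z) = (0 == k)%:R.
  have [<-|k0] := eqVneq 0 k.
    transitivity (\int[leb]_(z in `[0, L]) (L^-1 * trig true 0 z + 0 * trig true 0 z)).
      apply: eq_Rintegral => z _; rewrite omegaE eqxx -expr2 expr_div_n expr1n sL2.
      by rewrite /trig mulr0 !mul0r cos0 addr0 mul1r mulr1.
    by rewrite integral_trig2 eqxx mul0r addr0 mulVf.
  transitivity (\int[leb]_(z in `[0, L])
      ((1 / Num.sqrt L * Num.sqrt (2 / L)) * trig (k < 0) k z + 0 * trig true 0 z)).
    by apply: eq_Rintegral => z _; rewrite !omegaE eqxx eq_sym (negbTE k0) mul0r addr0 mulrA.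
  by rewrite integral_trig2 mul0r addr0 [k == 0]eq_sym (negbTE k0) andbF mulr0.
have [->|i0] := eqVneq i 0; first exact: constant_case.
have [->|j0] := eqVneq j 0.
  under eq_Rintegral do rewrite mulrC.
  by rewrite constant_case eq_sym.
pose ci := i < 0; pose cj := j < 0.
transitivity (\int[leb]_(z in `[0, L])
  ((if ci then L^-1 else if cj then L^-1 else - L^-1) * trig (ci == cj) (i + j) z +
   (if ci then if cj then L^-1 else - L^-1 else L^-1) * trig (ci == cj) (i - j) z)).
  apply: eq_Rintegral => z _.
  rewrite !omegaE (negbTE i0) (negbTE j0) -/ci -/cj mulrACA -expr2 s2 !trigD !trigN.
  by case: ci; case: cj => /=; field.
rewrite integral_trig2 subr_eq0 addr_eq0.
have [ij|ij] := eqVneq i j.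
  have -> : cj = ci by rewrite /cj /ci ij.
  rewrite eqxx -ij (_ : (i == - i) = false); last by apply/eqP; lia.
  by case: ci; rewrite /= mulr0 add0r mulVf.
rewrite andbF mulr0 addr0; case: (eqVneq i (- j)) => [iNj|_]; last by rewrite andbF mulr0.
rewrite (_ : (ci == cj) = false) ?mulr0//; apply/eqP; rewrite /ci /cj iNj; lia.
Qed.

Local Notation leb2 := (leb \x leb)%E.

Lemma integrable_torus_basis2 (j k : int * int) :
  leb2.-integrable (torus L) (fun x => (torus_basis L j x * torus_basis L k x)%:E).
Proof.
have cw i i' : continuous (fun z => omega L i z * omega L i' z).
  by move=> z; apply: cvgM; exact: continuous_omega.
have := @integrable_prod _ _ _ _ R leb leb `[0, L]%classic `[0, L]%classic _ _
  (measurable_itv _) (measurable_itv _) (continuous_integrable_period (cw j.1 k.1))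
  (continuous_integrable_period (cw j.2 k.2)).
rewrite (_ : (fun x => (omega L j.1 x.1 * omega L k.1 x.1 *
    (omega L j.2 x.2 * omega L k.2 x.2))%:E) =
    (fun x => (torus_basis L j x * torus_basis L k x)%:E))//.
by apply/funext => x; rewrite mulrACA.
Qed.

Lemma torus_basis_orthonormal (j k : int * int) :
  (\int[leb2]_(x in torus L) (torus_basis L j x * torus_basis L k x)%:E =
   ((j == k)%:R)%:E)%E.
Proof.
have cw i i' : continuous (fun z => omega L i z * omega L i' z).
  by move=> z; apply: cvgM; exact: continuous_omega.
have intw i i' := continuous_integrable_period (cw i i').
have := @integral_prod _ _ _ _ R leb leb `[0, L]%classic `[0, L]%classic _ _
  (measurable_itv _) (measurable_itv _) (intw j.1 k.1) (intw j.2 k.2).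
under eq_integral do rewrite mulrACA.
move=> ->.
have mI : measurable (`[0, L]%classic : set (measurableTypeR R)).
  exact: measurable_itv.
rewrite -(fineK (integrable_fin_num mI (intw j.1 k.1))).
rewrite -(fineK (integrable_fin_num mI (intw j.2 k.2))).
have := omega_orthonormal j.1 k.1; rewrite /Rintegral => ->.
have := omega_orthonormal j.2 k.2; rewrite /Rintegral => ->.
rewrite -EFinM -natrM mulnb -pair_eqE.
by case: j k => ? ? [].
Qed.

(** All the products of basis functions are integrable, so that the integral
    commutes with the finite sum and orthonormality selects the coefficient. *)
Lemma fourier_coef_sum (s : seq (int * int)) (c : int * int -> R) j : uniq s ->
  fourier_coef L (fun x => \sum_(k <- s) c k * torus_basis L k x) j =
  if j \in s then c j else 0.
Proof.
move=> us; rewrite /fourier_coef /Rintegral.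
have mT : measurable (torus L) by exact: measurableX.
transitivity (fine (\int[leb2]_(x in torus L)
    \sum_(k <- s) (c k)%:E * (torus_basis L k x * torus_basis L j x)%:E)%E).
  congr fine; apply: eq_integral => x _; rewrite mulr_suml -sumEFin.
  by apply: eq_bigr => k _; rewrite -mulrA EFinM.
rewrite integral_sum//; last first.
  by move=> k; apply: integrableZl => //; exact: integrable_torus_basis2.
under eq_bigr => k _.
  rewrite integralZl//; last exact: integrable_torus_basis2.
  rewrite torus_basis_orthonormal -EFinM; over.
rewrite sumEFin/=; case: ifPn => js.
  rewrite (bigD1_seq j)//= eqxx mulr1 big1 ?addr0// => k /negbTE ->.
  by rewrite mulr0.
rewrite big1_seq// => k /= ks; rewrite (_ : (k == j) = false) ?mulr0//.
by apply: contraNF js => /eqP <-.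
Qed.

End TrigBasis.

(** * The energy of the truncated convolution *)

Section Energy.
Context {R : realType}.
Variable L : R.
Hypothesis L0 : 0 < L.
Local Notation leb := (@lebesgue_measure R).

Definition first_eigenvalue : R := (2 * pi / L) ^+ 2.
Local Notation kappa := first_eigenvalue.

Lemma first_eigenvalue_gt0 : 0 < kappa.
Proof. by rewrite exprn_gt0// divr_gt0// mulr_gt0// pi_gt0. Qed.

Lemma laplace_eigenvalueE k : laplace_eigenvalue L k = kappa * @mode_norm R k ^+ 2.
Proof. by rewrite -exprMn /laplace_eigenvalue mulrAC. Qed.

Lemma mode_norm_sqr_ge1 k : k != 0 -> 1 <= @mode_norm R k ^+ 2.
Proof.
move=> k0; rewrite mode_norm_sqr ler1n lt0n -(@pnatr_eq0 R) -mode_norm_sqr.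
by rewrite sqrf_eq0 mode_norm_eq0.
Qed.

Lemma laplace_eigenvalue_ge k : k != 0 -> kappa <= laplace_eigenvalue L k.
Proof.
move=> k0; rewrite laplace_eigenvalueE ler_peMr ?mode_norm_sqr_ge1//.
exact/ltW/first_eigenvalue_gt0.
Qed.

Lemma laplace_eigenvalue_gt0 k : k != 0 -> 0 < laplace_eigenvalue L k.
Proof. by move=> /laplace_eigenvalue_ge; apply: lt_le_trans; exact: first_eigenvalue_gt0. Qed.

(** The squared L^2 norm of the kernel of the stochastic convolution. *)
Lemma integral_expR_sqr (t lambda : R) : 0 < t -> 0 < lambda ->
  (\int[leb]_(s in `[0%R, t]) (expR (- (t - s) * lambda) ^+ 2)%:E =
   ((1 - expR (- (2 * t * lambda))) / (2 * lambda))%:E)%E.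
Proof.
move=> t0 la0.
have la_neq0 : lambda != 0 by rewrite gt_eqF.
pose F (s : R) : R := (2 * lambda)^-1 * expR (2 * lambda * (s - t)).
have dF (s : R) : is_derive s 1 F (expR (- (t - s) * lambda) ^+ 2).
  have h : is_derive s 1 (fun y : R => 2 * lambda * (y - t)) (2 * lambda).
    by apply: is_derive_eq; rewrite /GRing.scale/=; ring.
  have := is_deriveZ (2 * lambda)^-1 (is_derive1_comp (is_derive_expR _) h).
  move=> H; apply: is_derive_eq H _; rewrite /GRing.scale/= expr2 -expRD.
  rewrite mulrCA mulVf ?mulr1; last by rewrite mulf_neq0.
  by congr expR; ring.
have cF : continuous F.
  move=> z; apply: differentiable_continuous.
  by apply/derivable1_diffP; have [] := dF z.
rewrite (@continuous_FTC2 R _ F)//.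
- rewrite /F -EFinB; congr EFin; rewrite subrr mulr0 expR0 sub0r.
  rewrite (_ : 2 * lambda * - t = - (2 * t * lambda)); last by ring.
  by field.
- have cexp : continuous (fun s : R => expR (- (t - s) * lambda)).
    move=> s; apply: (@continuous_comp _ _ _ (fun s : R => - (t - s) * lambda) expR).
      apply: cvgM; last exact: cvg_cst.
      by apply: cvgN; apply: cvgB; [exact: cvg_cst|exact: cvg_id].
    exact: continuous_expR.
  by apply: continuous_subspaceT => s; exact: (cvgM (cexp s) (cexp s)).
- split => [x _||]; first by have [] := dF x.
    exact/cvg_at_right_filter/cF.
  exact/cvg_at_left_filter/cF.
- by move=> x _; rewrite derive1E; have [_ ->] := dF x.
Qed.

Lemma H1_norm_sq_sum (s : seq (int * int)) (c : int * int -> R) : uniq s ->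
  (forall k, k \in s -> k != 0) ->
  H1_norm_sq L (fun x => \sum_(k <- s) c k * torus_basis L k x) =
  (\sum_(k <- s) (laplace_eigenvalue L k * c k ^+ 2)%:E)%E.
Proof.
move=> us s0; rewrite /H1_norm_sq.
transitivity (\esum_(k in [set k : int * int | k != 0])
    if k \in [set` s] then (laplace_eigenvalue L k * c k ^+ 2)%:E else 0%E).
  apply: eq_esum => k _; rewrite fourier_coef_sum// mem_setE.
  by case: ifP => _; rewrite ?normr0 ?expr0n ?mulr0// real_normK// num_real.
rewrite -esum_mkcondr setIidr; last by move=> k /= /s0.
rewrite esum_fset//; last first.
  by move=> k _; rewrite lee_fin mulr_ge0// sqr_ge0.
  exact: finite_seq.
by rewrite [RHS]fsbig_seq.
Qed.

Context {d : measure_display} {Omega : measurableType d} (P : probability Omega R).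

Lemma truncated_convolution_seqE (Z : int * int -> R -> {RV P >-> R}) alpha N t w :
  truncated_convolution L Z alpha N t w =
  fun x => \sum_(k <- @low_mode_seq R N)
    (laplace_eigenvalue L k `^ (alpha / 2) * Z k t w) * torus_basis L k x.
Proof.
apply/funext => x; rewrite [RHS]fsbig_seq ?uniq_low_mode_seq//.
by rewrite -low_modes_seqE.
Qed.

Lemma low_mode_seq_neq0 N k : k \in @low_mode_seq R N -> k != 0.
Proof. by rewrite mem_low_mode_seq inE => /low_modesE/andP[]. Qed.

(** The exponent alpha - 1 is the sum of alpha, from the weights of the
    convolution, of 1, from the H^1 norm, and of - 2, from the second moment of
    Z_k(t). *)
Lemma energyE (beta Z : int * int -> R -> {RV P >-> R}) alpha N (t : R) :
  iid_brownian_motions beta -> mode_convolution L beta Z -> 0 < t ->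
  (\int[P]_w H1_norm_sq L (truncated_convolution L Z alpha N t w) =
   (\sum_(k <- @low_mode_seq R N) 2^-1 *
     (1 - expR (- (2 * t * laplace_eigenvalue L k ^+ 2))) *
     laplace_eigenvalue L k `^ (alpha - 1))%:E)%E.
Proof.
move=> [bB _] hZ t0.
transitivity (\int[P]_w \sum_(k <- @low_mode_seq R N)
  ((laplace_eigenvalue L k * (laplace_eigenvalue L k `^ (alpha / 2)) ^+ 2)%:E *
    (Z k t w ^+ 2)%:E))%E.
  apply: eq_integral => w _; rewrite truncated_convolution_seqE H1_norm_sq_sum//.
  - by apply: eq_bigr => k _; rewrite -EFinM exprMn mulrA.
  - exact: uniq_low_mode_seq.
  - by move=> k; exact: low_mode_seq_neq0.
have mZ2 k : measurable_fun setT (fun w => (Z k t w ^+ 2)%:E).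
  exact/measurable_EFinP/measurable_funX.
have c0 k : 0 <= laplace_eigenvalue L k * (laplace_eigenvalue L k `^ (alpha / 2)) ^+ 2.
  by rewrite mulr_ge0// sqr_ge0.
rewrite ge0_integral_sum//; last 2 first.
- by move=> k; exact: measurable_funeM.
- by move=> k w _; rewrite mule_ge0 ?lee_fin ?sqr_ge0// c0.
rewrite -sumEFin big_seq [RHS]big_seq; apply: eq_bigr => k /low_mode_seq_neq0 k0.
rewrite ge0_integralZl_EFin//; last by move=> w _; rewrite lee_fin sqr_ge0.
have m0 := laplace_eigenvalue_gt0 k0.
have l0 : 0 < laplace_eigenvalue L k ^+ 2 by rewrite exprn_gt0.
rewrite (ito_isometry (bB k k0) _ (hZ k t k0 (ltW t0))); last first.
  apply: measurable_funTS; apply: measurableT_comp => //.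
  apply: measurable_funM => //; apply: measurableT_comp => //.
  exact: measurable_funB.
rewrite integral_expR_sqr// -EFinM; congr EFin.
rewrite -powR_mulrn ?powR_ge0// -powRrM divfK//.
rewrite powRB; last by apply/implyP => _; rewrite gt_eqF.
by rewrite powRr1 ?ltW//; field; rewrite gt_eqF.
Qed.

(** The factor 1 - exp (- 2 t mu^2) increases with mu, so that it is bounded
    below by its value at the smallest nonzero eigenvalue, and above by 1. *)
Lemma energy_bounds (beta Z : int * int -> R -> {RV P >-> R}) alpha (t : R) :
  iid_brownian_motions beta -> mode_convolution L beta Z -> 0 < t ->
  exists c C : R, [/\ 0 < c, 0 < C & forall N,
    let S := \sum_(k <- @low_mode_seq R N) (@mode_norm R k ^+ 2) `^ (alpha - 1) in
    let energy := (\int[P]_w H1_norm_sq L (truncated_convolution L Z alpha N t w))%E in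
    ((c * S)%:E <= energy)%E /\ (energy <= (C * S)%:E)%E].
Proof.
move=> hbeta hZ t0.
have k0 := first_eigenvalue_gt0.
have p0 : 0 < kappa `^ (alpha - 1) by rewrite powR_gt0.
pose c := 2^-1 * (1 - expR (- (2 * t * kappa ^+ 2))).
have c0 : 0 < c.
  rewrite mulr_gt0// subr_gt0 expR_lt1 oppr_lt0.
  by apply: mulr_gt0; [exact: mulr_gt0|exact: exprn_gt0].
exists (c * kappa `^ (alpha - 1)), (2^-1 * kappa `^ (alpha - 1)); split.
- exact: mulr_gt0.
- exact: mulr_gt0.
move=> N /=; rewrite (energyE alpha N hbeta hZ t0) !lee_fin !mulr_sumr.
have termE k : laplace_eigenvalue L k `^ (alpha - 1) =
    kappa `^ (alpha - 1) * (@mode_norm R k ^+ 2) `^ (alpha - 1).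
  by rewrite laplace_eigenvalueE powRM ?sqr_ge0// ltW.
split; rewrite big_seq [leRHS]big_seq; apply: ler_sum => k /low_mode_seq_neq0 kn0;
    rewrite termE.
  rewrite -[leLHS]mulrA; apply: ler_wpM2r; first by rewrite mulr_ge0 ?powR_ge0.
  rewrite /c ler_pM2l ?invr_gt0// lerD2l lerN2 ler_expR lerN2 ler_pM2l ?mulr_gt0//.
  by rewrite ler_sqr ?nnegrE ?(ltW k0) ?laplace_eigenvalue_ge// ltW// laplace_eigenvalue_gt0.
rewrite -[leRHS]mulrA; apply: ler_wpM2r; first by rewrite mulr_ge0 ?powR_ge0.
by rewrite ler_piMr ?invr_ge0// gerBl expR_ge0.
Qed.

End Energy.

Theorem lemma4p1 (R : realType) (d : measure_display) (Omega : measurableType d)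
    (P : probability Omega R) (L : R) (hL : 0 < L)
    (beta Z : int * int -> R -> {RV P >-> R})
    (hbeta : iid_brownian_motions beta)
    (hZ : mode_convolution L beta Z)
    (Tmax : R) (hT : 0 < Tmax) (alpha : R) (halpha : 0 <= alpha < 1)
    (t : R) (ht : 0 < t <= Tmax) :
  exists c C : R, [/\ 0 < c, 0 < C &
    forall N : nat, (2 <= N)%N ->
      let rate : R :=
        if alpha == 0 then ln N%:R else N%:R `^ (2 * alpha) in
      let energy : \bar R :=
        (\int[P]_w H1_norm_sq L (truncated_convolution L Z alpha N t w))%E in
      ((c * rate)%:E <= energy)%E /\ (energy <= (C * rate)%:E)%E].
Proof.
have /andP[t0 _] := ht.
have [c [C [c0 C0 energy]]] := energy_bounds hL alpha hbeta hZ t0.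
have [cs cs0 lower] := power_sum_growth_ge halpha.
have [Cs Cs0 upper] := power_sum_growth_le halpha.
exists (c * (2^-1 * cs)), (C * (16 * Cs)); split; rewrite ?mulr_gt0//.
move=> N N2; have [lo up] := energy N; split.
  apply: le_trans lo; rewrite lee_fin -!mulrA ler_pM2l//.
  apply: le_trans (low_mode_sum_ge N halpha).
  by rewrite ler_pM2l// lower.
apply: le_trans up _; rewrite lee_fin -!mulrA ler_pM2l//.
apply: le_trans (low_mode_sum_le N halpha) _.
by rewrite ler_pM2l// upper.
Qed.
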